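(* Let $E$ be a finite set of equations between (finite) terms. Assume that there exists a run of MMA on $E$ in which action (6) is not performed. Then every run of MMA$^-$ on $E$ that terminates is correct; that is, it terminates with failure if $E$ is not unifiable, and if $E$ is unifiable it terminates with a solved equation set representing a most general unifier of $E$.
   Context: MMA (Martelli–Montanari algorithm) on a finite equation set repeatedly, nondeterministically, selects an equation of one of these forms and performs the action: (1) $f(s_1,\dots,s_n)=f(t_1,\dots,t_n)$: replace it by $s_1=t_1,\dots,s_n=t_n$; (2) $f(s_1,\dots,s_n)=g(t_1,\dots,t_m)$ with $f\neq g$: halt with failure; (3) $X=X$: delete it; (4) $t=X$ with $t$ not a variable: replace by $X=t$; (5) $X=t$ with $X\notin\mathrm{Var}(t)$ and $X$ occurring elsewhere (in another equation): apply $\{X/t\}$ to all other equations; (6) $X=t$ with $X\in\mathrm{Var}(t)$ and $X\neq t$: halt with failure. It terminates with success when no action applies; then the equation set is solved, i.e. of the form $\{X_1=t_1,\dots,X_n=t_n\}$ with $X_1,\dots,X_n$ distinct variables none of which occurs in any $t_k$, and it represents the mgu $\{X_1/t_1,\dots,X_n/t_n\}$. MMA$^-$ (MMA without occur-check) is obtained from MMA by: (a) removing action (6); (b) replacing the condition $X\notin\mathrm{Var}(t)$ in action (5) by $X\neq t$; (c) adding action (5'): for an equation $X=t$ with $X\neq t$ where $X$ occurs elsewhere, replace some (any chosen) occurrences of $X$ in the other equations by $t$; (d) action (5') may be performed on $X=t$ only if action (5) has previously been performed in the run on some equation $X=t'$ (same variable $X$). A set $\{X_1=t_1,\dots,X_n=t_n\}$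 is semi-solved if the $X_i$ are distinct variables, no $t_i$ is $X_i$, and whenever $X_i$ occurs in some $t_k$ then $X_i \succ^+ X_i$, where $\succ^+$ is the transitive closure of the relation $X_i\succ X_k$ iff $X_k\in\mathrm{Var}(t_i)$. A run of MMA$^-$ terminates with failure when it performs action (2), and terminates with success when it stops at a semi-solved equation set (it may also choose to continue applying actions).
   Formalization: If E is unifiable, the final set is claimed solved and to represent an mgu only if it has no cycle X1=X2, ..., Xk=X1 of variables; otherwise false: {X=Y, Y=X} is semi-solved and unifiable but not solved. *)

(* Defs.v *)
(* MathComp, with finmap for finite sets and finitely supported functions. *)
From HB Require Import structures.
From Stdlib Require Import Relation_Operators.
From mathcomp Require Import all_boot.
From mathcomp Require Import finmap.

Set Implicit Arguments.
Unset Strict Implicit.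
Unset Printing Implicit Defensive.

Local Open Scope fset_scope.

Section Unification.
(* [F] is the set of function symbols ([ar f] the arity of [f], constants having
   arity 0) and [V] the set of variables. *)
Variables (F V : choiceType) (ar : F -> nat).

Unset Elimination Schemes.
Inductive term : Type :=
| Var of V
| App (f : F) of {ffun 'I_(ar f) -> term}.
Set Elimination Schemes.

Lemma term_ind (P : term -> Prop) :
  (forall x, P (Var x)) ->
  (forall f (a : {ffun 'I_(ar f) -> term}), (forall i, P (a i)) -> P (App a)) ->
  forall t, P t.
Proof.
by move=> PV PA; fix IH 1 => -[x|f a]; [apply: PV | apply: PA => i; apply: IH].
Qed.

Fixpoint term_encode (t : term) : GenTree.tree (V + F) :=
  match t with
  | Var x => GenTree.Leaf (inl x)
  | App f a =>
      GenTree.Node 0 (GenTree.Leaf (inr f) :: codom (fun i => term_encode (a i)))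
  end.

Fixpoint term_decode (g : GenTree.tree (V + F)) : option term :=
  match g with
  | GenTree.Leaf (inl x) => Some (Var x)
  | GenTree.Node _ (GenTree.Leaf (inr f) :: l) =>
      omap (fun u : (ar f).-tuple term => App [ffun i => tnth u i])
           (insub (pmap term_decode l))
  | _ => None
  end.

Lemma term_encodeK : pcancel term_encode term_decode.
Proof.
elim=> [x|f a IH] //=.
have -> : pmap term_decode (codom (fun i => term_encode (a i)))
          = [tuple a i | i < ar f].
  rewrite /= /codom /image_mem; elim: (enum _) => //= i s ->.
  by rewrite IH.
rewrite valK /=; congr (Some (App _)).
by apply/ffunP=> i; rewrite ffunE tnth_mktuple.
Qed.

HB.instance Definition _ := Choice.copy term (pcan_type term_encodeK).

Definition equation := (term * term)%type.
Definition eqset := {fset equation}.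

Fixpoint occurs (x : V) (t : term) : bool :=
  match t with
  | Var y => x == y
  | App f a => [exists i, occurs x (a i)]
  end.

Definition occurs_eqn x (e : equation) := occurs x e.1 || occurs x e.2.

Definition subst := {fsfun V -> term for Var}.

Fixpoint apply (s : V -> term) (t : term) : term :=
  match t with
  | Var x => s x
  | App f a => App [ffun i => apply s (a i)]
  end.

Definition apply_eqn s (e : equation) : equation := (apply s e.1, apply s e.2).

Definition bind (x : V) (t : term) : V -> term :=
  fun y => if y == x then t else Var y.

Definition unifier (s : subst) (E : eqset) :=
  forall e, e \in E -> apply s e.1 = apply s e.2.

Definition unifiable (E : eqset) := exists s, unifier s E.

Definition mgu (s : subst) (E : eqset) :=
  unifier s E /\
  forall s', unifier s' E ->
    exists g : subst, forall x, s' x = apply g (s x).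

(* [E] has the form {x_1 = t_1, ..., x_n = t_n} with distinct x_1, ..., x_n. *)
Definition explicit_form (E : eqset) :=
  (forall e, e \in E -> exists x, e.1 = Var x) /\
  (forall x t u, (Var x, t) \in E -> (Var x, u) \in E -> t = u).

Definition lhs_var (E : eqset) x := exists t, (Var x, t) \in E.

Definition solved (E : eqset) :=
  explicit_form E /\
  forall x y t, lhs_var E x -> (Var y, t) \in E -> ~~ occurs x t.

Definition represents (E : eqset) (s : subst) :=
  (forall x t, (Var x, t) \in E -> s x = t) /\
  (forall x, ~ lhs_var E x -> s x = Var x).

Definition succ (E : eqset) (x y : V) :=
  lhs_var E y /\ exists2 t, (Var x, t) \in E & occurs y t.

Definition semi_solved (E : eqset) :=
  [/\ explicit_form E,
      forall x, (Var x, Var x) \notin E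
    & forall x y t, lhs_var E x -> (Var y, t) \in E -> occurs x t ->
        clos_trans V (succ E) x x].

(* [E] contains equations x_1 = x_2, x_2 = x_3, ..., x_k = x_1 between
   variables. [semi_solved] excludes this only for k = 1: {x = y, y = x} is
   unifiable and semi-solved (as x succ y succ x), but not solved. *)
Definition var_cycle (E : eqset) :=
  exists x, clos_trans V (fun y z => (Var y, Var z) \in E) x x.

(* [PartialEliminate] is only used by MMA^-, the algorithm without occur-check
   (prefix [mmam] below), and [OccurCheck] only by MMA. *)
Inductive rule :=
  Decompose | Clash | Delete | Orient | Eliminate | PartialEliminate | OccurCheck.

Inductive state := Eqns of eqset | Failure.

Definition elsewhere (E : eqset) (e : equation) (x : V) :=
  exists2 e', e' \in E `\ e & occurs_eqn x e'.

(* [common_step E k e q]: rule [k] performed on the selected equation [e] of [E]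
   results in [q], for the actions that both algorithms share. *)
Inductive common_step (E : eqset) : rule -> equation -> state -> Prop :=
| StepDecompose f (a b : {ffun 'I_(ar f) -> term}) :
    (App a, App b) \in E ->
    common_step E Decompose (App a, App b)
      (Eqns ((E `\ (App a, App b)) `|` [fset (a i, b i) | i in 'I_(ar f)]))
| StepClash f g (a : {ffun 'I_(ar f) -> term}) (b : {ffun 'I_(ar g) -> term}) :
    (App a, App b) \in E -> f <> g ->
    common_step E Clash (App a, App b) Failure
| StepDelete x :
    (Var x, Var x) \in E ->
    common_step E Delete (Var x, Var x) (Eqns (E `\ (Var x, Var x)))
| StepOrient f (a : {ffun 'I_(ar f) -> term}) x :
    (App a, Var x) \in E ->
    common_step E Orient (App a, Var x)
      (Eqns ((Var x, App a) |` (E `\ (App a, Var x)))).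

Definition eliminate (E : eqset) (x : V) (t : term) : eqset :=
  (Var x, t) |` [fset apply_eqn (bind x t) e | e in E `\ (Var x, t)].

Inductive mma_step (E : eqset) : rule -> equation -> state -> Prop :=
| MmaCommon k e q : common_step E k e q -> mma_step E k e q
| MmaEliminate x t :
    (Var x, t) \in E -> ~~ occurs x t -> elsewhere E (Var x, t) x ->
    mma_step E Eliminate (Var x, t) (Eqns (eliminate E x t))
| MmaOccurCheck x t :
    (Var x, t) \in E -> occurs x t -> Var x <> t ->
    mma_step E OccurCheck (Var x, t) Failure.

(* [replace_some x t u u']: [u'] is [u] with some (possibly none, possibly all)
   occurrences of [x] replaced by [t]. *)
Inductive replace_some (x : V) (t : term) : term -> term -> Prop :=
| ReplaceKeep u : replace_some x t u u
| ReplaceVar : replace_some x t (Var x) t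
| ReplaceApp f (a b : {ffun 'I_(ar f) -> term}) :
    (forall i, replace_some x t (a i) (b i)) ->
    replace_some x t (App a) (App b).

Definition replace_some_eqn x t (e e' : equation) :=
  replace_some x t e.1 e'.1 /\ replace_some x t e.2 e'.2.

(* In [MmamPartialEliminate], [r] gives the chosen replacements; as [t] differs
   from [x], [r e <> e] says that an occurrence is really replaced in [e]. *)
Inductive mmam_step (E : eqset) : rule -> equation -> state -> Prop :=
| MmamCommon k e q : common_step E k e q -> mmam_step E k e q
| MmamEliminate x t :
    (Var x, t) \in E -> Var x <> t -> elsewhere E (Var x, t) x ->
    mmam_step E Eliminate (Var x, t) (Eqns (eliminate E x t))
| MmamPartialEliminate x t (r : equation -> equation) :
    (Var x, t) \in E -> Var x <> t -> elsewhere E (Var x, t) x ->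
    (forall e, e \in E `\ (Var x, t) -> replace_some_eqn x t e (r e)) ->
    (exists2 e, e \in E `\ (Var x, t) & r e <> e) ->
    mmam_step E PartialEliminate (Var x, t)
      (Eqns ((Var x, t) |` [fset r e | e in E `\ (Var x, t)])).

(* A finite ([len = Some n], for n steps) or infinite ([len = None]) sequence of
   steps: step [i] leads from state [st i] to state [st i.+1] by performing rule
   [act i] on equation [sel i]. Values beyond the length are irrelevant. *)
Record trace := Trace {
  len : option nat;
  st : nat -> state;
  act : nat -> rule;
  sel : nat -> equation }.

Definition performed (r : trace) (i : nat) :=
  if len r is Some n then i < n else true.

Definition follows (step : eqset -> rule -> equation -> state -> Prop)
    (E : eqset) (r : trace) :=
  st r 0 = Eqns E /\
  forall i, performed r i ->
    exists2 S, st r i = Eqns S & step S (act r i) (sel r i) (st r i.+1).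

(* Runs of MMA are maximal: a finite one stops after a failing action, or
   (success) when no action applies. *)
Definition mma_run (E : eqset) (r : trace) :=
  follows mma_step E r /\
  forall n S k e q, len r = Some n -> st r n = Eqns S -> ~ mma_step S k e q.

(* Elimination may be partial for [x = t] only if [x] has been eliminated by a
   full one, with a possibly different [t'], earlier in the run. Maximality is
   not required: a run may stop at a semi-solved set or be continued. *)
Definition mmam_run (E : eqset) (r : trace) :=
  follows mmam_step E r /\
  forall i x t, performed r i ->
    act r i = PartialEliminate -> sel r i = (Var x, t) ->
    exists j t', [/\ j < i, act r j = Eliminate & sel r j = (Var x, t')].

Definition mmam_terminates (r : trace) (n : nat) :=
  len r = Some n /\
  (st r n = Failure \/ exists2 S, st r n = Eqns S & semi_solved S).

End Unification.

(* Main.v *)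
(* Call a relation on terms a solution if it is an equivalence that is compatible
   with all function symbols, injective in their arguments, and never relates
   terms with distinct head symbols. Having the same instance under a given
   substitution is a solution, and so is having the same unfolding into an
   infinite tree with respect to a set of equations x_i = t_i with distinct x_i.
   A step of MMA^- preserves in both directions the property that all equations
   are in a given solution, and it fails only if this property does not hold.

   If E is unifiable, then a run of MMA^- cannot fail, and its final set S has the
   unifiers of E. A succ-cycle in S consists of equations between variables, since
   otherwise a unifier would map a variable to a term larger than itself.

   If a run of MMA^- ends at a semi-solved S, then S, hence E, holds in the
   infinite-tree solution given by S. A run of MMA on E without occur-check
   failure is also a run of MMA^-, so it does not fail; it terminates, and its
   final set is solved and has the unifiers of E. So E is unifiable. *)

Require Import Defs.
From Stdlib Require Import Relation_Operators.
From mathcomp Require Import all_boot.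
From mathcomp Require Import finmap.

Set Implicit Arguments.
Unset Strict Implicit.
Unset Printing Implicit Defensive.

Local Open Scope fset_scope.

Section UnificationWithoutOccurCheck.
Variables (F V : choiceType) (ar : F -> nat).
Notation term := (term V ar).
Notation eqset := (eqset V ar).
Notation equation := (equation V ar).
Notation subst := (subst V ar).
Implicit Types (t u : term) (E S : eqset) (x y z : V) (e : equation).

(** * Solutions and their preservation by steps of MMA^- *)

Lemma App_inj f : injective (@App F V ar f).
Proof.
move=> a b eq_ab.
(* The type of the arguments depends on the symbol, so dependent pairs are compared; decidable
   equality on [F] then identifies the arguments. *)
pose g t := if t is App h c then Some (existT (fun h => {ffun 'I_(ar h) -> term}) h c)
            else None.
have [] : g (App a) = g (App b) by rewrite eq_ab.
exact: eq_from_Tagged.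
Qed.

Lemma App_eq_symbol f g (a : {ffun 'I_(ar f) -> term})
    (b : {ffun 'I_(ar g) -> term}) : App a = App b -> f = g.
Proof. by case. Qed.

Record solution_relation (R : term -> term -> Prop) : Prop := SolutionRelation {
  sol_refl : forall t, R t t;
  sol_sym : forall t u, R t u -> R u t;
  sol_trans : forall t u v, R t u -> R u v -> R t v;
  sol_app : forall f (a b : {ffun 'I_(ar f) -> term}),
    R (App a) (App b) <-> forall i, R (a i) (b i);
  sol_symbol : forall f g (a : {ffun 'I_(ar f) -> term})
    (b : {ffun 'I_(ar g) -> term}), R (App a) (App b) -> f = g }.

Definition holds (R : term -> term -> Prop) E := forall e, e \in E -> R e.1 e.2.

(** Full elimination is an instance of [replace_some], so one argument covers both elimination
    rules. *)
Lemma bind_replace_some x t u : replace_some x t u (apply (bind x t) u).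
Proof.
elim: u => [y|f a IH] /=.
  rewrite /bind; case: eqP => [->|_]; [exact: ReplaceVar|exact: ReplaceKeep].
by apply: ReplaceApp => i; rewrite ffunE.
Qed.

Section Preservation.
Variable R : term -> term -> Prop.
Hypothesis solR : solution_relation R.

Lemma replace_some_sol x t u u' :
  R (Var ar x) t -> replace_some x t u u' -> R u u'.
Proof.
move=> Rxt; elim=> // [v|f a b _ IH]; first exact: sol_refl.
by apply/(sol_app solR).
Qed.

(** The equation [x = t] is kept, so [R] relates [x] and [t] whichever set is assumed to hold, and
    replacing [x] by [t] stays within a class of [R]. *)
Lemma replace_holds E x t (r : equation -> equation) :
  (Var ar x, t) \in E ->
  (forall e, e \in E `\ (Var ar x, t) -> replace_some_eqn x t e (r e)) ->
  holds R E <-> holds R ((Var ar x, t) |` [fset r e | e in E `\ (Var ar x, t)]).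
Proof.
move=> xtE rP; split=> holdsE e.
  case/fset1UP=> [->|/imfsetP [e' /= e'E ->]]; first exact: (holdsE _ xtE).
  have [r1 r2] := rP _ e'E; have Rxt := holdsE _ xtE.
  have Re' : R e'.1 e'.2 by apply: holdsE; move: e'E; rewrite in_fsetD1 => /andP [].
  apply: (sol_trans solR) (replace_some_sol Rxt r2).
  exact: (sol_trans solR) (sol_sym solR (replace_some_sol Rxt r1)) Re'.
move=> eE; have Rxt : R (Var ar x) t.
  by apply: (holdsE (Var ar x, t)); rewrite fset1U1.
have [->//|neq_e] := eqVneq e (Var ar x, t).
have eE' : e \in E `\ (Var ar x, t) by rewrite in_fsetD1 neq_e.
have [r1 r2] := rP _ eE'.
have Rre : R (r e).1 (r e).2 by apply: holdsE; apply/fset1UP; right; apply: in_imfset.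
apply: (sol_trans solR) (replace_some_sol Rxt r1) _.
exact: (sol_trans solR) Rre (sol_sym solR (replace_some_sol Rxt r2)).
Qed.

Lemma mmam_step_holds E k e q :
  mmam_step E k e q ->
  match q with
  | Eqns E' => holds R E <-> holds R E'
  | Failure => ~ holds R E
  end.
Proof.
case=> [{}k {}e {}q|x t xtE _ _|x t r xtE _ _ rP _]; last 2 first.
- by apply: replace_holds => // e' _; split; apply: bind_replace_some.
- exact: replace_holds.
case=> [f a b abE|f g a b abE neq_fg|x xE|f a x axE].
- split=> holdsE e'.
    case/fsetUP=> [|/imfsetP [i /= _ ->]].
      by rewrite in_fsetD1 => /andP [_]; apply: holdsE.
    exact: (proj1 (sol_app solR _ _) (holdsE _ abE)).
  have [->|neq_e] := eqVneq e' (App a, App b) => e'E.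
    apply/(sol_app solR) => i; apply: (holdsE (a i, b i)).
    by apply/fsetUP; right; apply: (in_imfset _ (fun i => (a i, b i))).
  by apply: holdsE; apply/fsetUP; left; rewrite in_fsetD1 neq_e.
- by move=> holdsE; apply: neq_fg; apply: (sol_symbol solR (holdsE _ abE)).
- split=> holdsE e'; first by rewrite in_fsetD1 => /andP [_]; apply: holdsE.
  have [-> _|neq_e e'E] := eqVneq e' (Var ar x, Var ar x); first exact: sol_refl.
  by apply: holdsE; rewrite in_fsetD1 neq_e.
- split=> holdsE e'.
    case/fset1UP=> [->|]; first exact: (sol_sym solR (holdsE _ axE)).
    by rewrite in_fsetD1 => /andP [_]; apply: holdsE.
  have [-> _|neq_e e'E] := eqVneq e' (App a, Var ar x).
    by apply: (sol_sym solR); apply: (holdsE (Var ar x, App a)); rewrite fset1U1.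
  by apply: holdsE; apply/fset1UP; right; rewrite in_fsetD1 neq_e.
Qed.

Lemma mmam_holds E (r : trace V ar) n :
  follows (@mmam_step F V ar) E r -> (forall i, i < n -> performed r i) ->
  match st r n with
  | Eqns T => holds R E <-> holds R T
  | Failure => ~ holds R E
  end.
Proof.
move=> [st0 steps]; elim: n => [|n IH] perf; first by rewrite st0.
have [T stT /mmam_step_holds] := steps n (perf n (ltnSn n)).
have := IH (fun i lt_in => perf i (ltnW lt_in)); rewrite stT => holdsT.
by case: (st r n.+1) => [T'|]; rewrite holdsT.
Qed.

End Preservation.

(** * MMA as part of MMA^-, and the solution given by a substitution *)

Lemma mma_step_mmam E k e q :
  mma_step E k e q -> k <> OccurCheck -> mmam_step E k e q.
Proof.
case=> [{}k {}e {}q stepE _|x t xtE nocc else_x _|//]; first exact: MmamCommon.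
by apply: MmamEliminate => // eq_xt; rewrite -eq_xt /= eqxx in nocc.
Qed.

Lemma follows_mma_mmam E (r : trace V ar) :
  follows (@mma_step F V ar) E r ->
  (forall i, performed r i -> act r i <> OccurCheck) ->
  follows (@mmam_step F V ar) E r.
Proof.
move=> [st0 steps] noOC; split=> // i perf; have [T stT stepT] := steps i perf.
by exists T => //; apply: mma_step_mmam (noOC i perf).
Qed.

(** For this relation, [holds] unfolds to [unifier]. *)
Definition same_instance (s : subst) t u := apply s t = apply s u.

Lemma same_instance_sol s : solution_relation (same_instance s).
Proof.
split; rewrite /same_instance //=.
- by move=> t u v -> ->.
- move=> f a b; split=> [/App_inj /ffunP eq_ab i|eq_ab].
    by have := eq_ab i; rewrite !ffunE.
  by congr App; apply/ffunP=> i; rewrite !ffunE.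
- by move=> f g a b /App_eq_symbol.
Qed.

(** * Infinite trees given by an explicit set of equations *)

Section RationalTrees.
Variable S : eqset.
Hypothesis explS : explicit_form S.

(** The head of the unfolding: chains of variable equations are followed up to an application or a
    variable that is no left-hand side. *)
Inductive resolves : term -> term -> Prop :=
| ResolvesVar x t h : (Var ar x, t) \in S -> resolves t h -> resolves (Var ar x) h
| ResolvesFree x : ~ lhs_var S x -> resolves (Var ar x) (Var ar x)
| ResolvesApp f (a : {ffun 'I_(ar f) -> term}) : resolves (App a) (App a).

Inductive same_head (Q : term -> term -> Prop) : term -> term -> Prop :=
| SameVar x : same_head Q (Var ar x) (Var ar x)
| SameApp f (a b : {ffun 'I_(ar f) -> term}) :
    (forall i, Q (a i) (b i)) -> same_head Q (App a) (App b).

(** A term without head is vacuously simulated by any term, so [tree_eq] asks for both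
    directions. *)
Definition simulated (Q : term -> term -> Prop) t u :=
  forall h, resolves t h -> exists2 h', resolves u h' & same_head Q h h'.

(* Equality down to depth [n] of the trees obtained by unfolding [S]; all
   variables on or leading to a variable cycle, which resolve to nothing, are
   identified. *)
Fixpoint tree_eq n t u : Prop :=
  if n is n'.+1 then
    simulated (tree_eq n') t u /\ simulated (tree_eq n') u t
  else True.

Lemma resolves_App f (a : {ffun 'I_(ar f) -> term}) h :
  resolves (App a) h -> h = App a.
Proof.
move E: (App a) => t res; case: res E => // g b E.
Qed.

Lemma same_head_AppP Q f (a b : {ffun 'I_(ar f) -> term}) :
  same_head Q (App a) (App b) -> forall i, Q (a i) (b i).
Proof.
move Ea: (App a) => t; move Eb: (App b) => u h.
case: h Ea Eb => // g c d Qcd Ea Eb.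
have eq_fg := App_eq_symbol Ea; subst g.
by rewrite (App_inj Ea) (App_inj Eb).
Qed.

Lemma same_head_symbol Q f g (a : {ffun 'I_(ar f) -> term})
    (b : {ffun 'I_(ar g) -> term}) : same_head Q (App a) (App b) -> f = g.
Proof.
move Ea: (App a) => t; move Eb: (App b) => u h.
by case: h Ea Eb => // k c d _ /App_eq_symbol -> /App_eq_symbol ->.
Qed.

Lemma same_head_trans Q t u v :
  (forall t u v, Q t u -> Q u v -> Q t v) ->
  same_head Q t u -> same_head Q u v -> same_head Q t v.
Proof.
move=> trQ [x //|f a b Qab] huv.
move Eb: (App b) huv => w huv; case: huv Eb => // g c d Qcd Eb.
have eq_fg := App_eq_symbol Eb; subst g; move/App_inj: Eb => Eb; subst c.
by apply: SameApp => i; apply: trQ (Qab i) (Qcd i).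
Qed.

Lemma simulated_App Q f (a b : {ffun 'I_(ar f) -> term}) :
  simulated Q (App a) (App b) <-> forall i, Q (a i) (b i).
Proof.
split=> [sim|Qab h /resolves_App ->].
  by have [h /resolves_App -> /same_head_AppP] := sim _ (ResolvesApp a).
by exists (App b); [exact: ResolvesApp | exact: SameApp].
Qed.

Lemma tree_eq_refl n t : tree_eq n t t.
Proof.
elim: n t => [//|n IH] t /=.
suff sim : simulated (tree_eq n) t t by [].
move=> h res; exists h => //; elim: {res}h => [x|f a _]; first exact: SameVar.
exact: SameApp.
Qed.

Lemma tree_eq_sym n t u : tree_eq n t u -> tree_eq n u t.
Proof. by case: n => //= n []. Qed.

Lemma tree_eq_trans n t u v : tree_eq n t u -> tree_eq n u v -> tree_eq n t v.
Proof.
elim: n t u v => //= n IH t u v.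
have sim_trans t1 t2 t3 : simulated (tree_eq n) t1 t2 ->
    simulated (tree_eq n) t2 t3 -> simulated (tree_eq n) t1 t3.
  move=> sim12 sim23 h res; have [h2 res2 hh2] := sim12 _ res.
  have [h3 res3 h2h3] := sim23 _ res2; exists h3 => //.
  exact: same_head_trans hh2 h2h3.
by move=> [tu ut] [uv vu]; split; [apply: sim_trans uv|apply: sim_trans ut].
Qed.

Definition rational_eq t u := forall n, tree_eq n t u.

Lemma rational_eq_sol : solution_relation rational_eq.
Proof.
split.
- by move=> t n; apply: tree_eq_refl.
- by move=> t u tu n; apply: tree_eq_sym.
- by move=> t u v tu uv n; apply: tree_eq_trans (uv n).
- move=> f a b; split=> [ab i n|ab [//|n]].
    exact: (proj1 (simulated_App _ _ _) (ab n.+1).1).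
  by split; apply/simulated_App => i; [|apply: tree_eq_sym]; apply: ab.
- move=> f g a b ab; have [sim _] := ab 1.
  by have [h /resolves_App -> /same_head_symbol] := sim _ (ResolvesApp a).
Qed.

(** As [x] has a single equation [x = t], both sides resolve to the same heads, and their equality
    reduces to reflexivity at [t]. *)
Lemma explicit_rational_eq : holds rational_eq S.
Proof.
move=> [v t] /= vtS; have [/(_ _ vtS) /= [x eq_v] uniqS] := explS; subst v.
have resE h : resolves (Var ar x) h <-> resolves t h.
  split=> [|/(ResolvesVar vtS) //].
  move Ex: (Var ar x) => v res; case: res Ex => // [y u g yuS ug [eq_xy]|y ny [eq_xy]].
    by subst y; rewrite (uniqS _ _ _ vtS yuS).
  by subst y; case: ny; exists t.
move=> [//|n]; have [sim _] := tree_eq_refl n.+1 t.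
split=> h res; first by apply: sim; apply/resE.
by have [h' res' hh'] := sim _ res; exists h' => //; apply/resE.
Qed.

End RationalTrees.

(** * Solved sets and the mgus they represent *)

Lemma lhs_varP S x : reflect (lhs_var S x) (has (fun e => e.1 == Var ar x) S).
Proof.
apply: (iffP hasP) => [[[v t] vtS /= /eqP eq_v]|[t xtS]].
  by exists t; rewrite -eq_v.
by exists (Var ar x, t) => /=.
Qed.

Lemma explicit_represents S : explicit_form S -> exists s : subst, represents S s.
Proof.
move=> [_ uniqS].
pose lhs e : option V := if e.1 is Var x then Some x else None.
pose D := [fset x in pmap lhs S].
(* The default of [nth] makes [rhs x] equal to [Var x] if [x] is no left-hand side. *)
pose rhs x := (nth (Var ar x, Var ar x) S (find (fun e => e.1 == Var ar x) S)).2.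
exists [fsfun x in D => rhs x | Var ar x]; split=> [x t xtS|x /lhs_varP nx].
  have has_x : has (fun e => e.1 == Var ar x) S by apply/lhs_varP; exists t.
  rewrite fsfunE ifT; last first.
    by rewrite inE /= mem_pmap; apply/mapP; exists (Var ar x, t).
  have := nth_find (Var ar x, Var ar x) has_x.
  have := mem_nth (Var ar x, Var ar x) (etrans (esym (has_find _ S)) has_x).
  by rewrite /rhs; case: nth => v u /= /[swap] /eqP -> /uniqS; apply.
by rewrite fsfunE /rhs hasNfind // nth_default // if_same.
Qed.

Lemma apply_id (s : V -> term) t :
  (forall x, occurs x t -> s x = Var ar x) -> apply s t = t.
Proof.
elim: t => [x|f a IH] /= id_s; first by apply: id_s; rewrite /= eqxx.
congr App; apply/ffunP=> i; rewrite ffunE IH // => x xa.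
by apply: id_s; apply/existsP; exists i.
Qed.

(** No left-hand variable occurs on the right, so [s] fixes the right-hand sides. A unifier [s']
    equals [s] followed by [s'], hence is its own factor. *)
Lemma represents_mgu S s : solved S -> represents S s -> mgu s S.
Proof.
move=> [[lhsS uniqS] solS] [sS sN]; split.
  move=> [v t] vtS; have /= [x eq_v] := lhsS _ vtS; subst v => /=.
  rewrite (sS _ _ vtS) apply_id // => y yt; apply: sN => lhs_y.
  by have := solS _ _ _ lhs_y vtS; rewrite yt.
move=> s' unif; exists s' => x.
have [[t xtS]|nx] := lhs_varP S x; first by rewrite (sS _ _ xtS); apply: (unif _ xtS).
by rewrite sN.
Qed.

(** * Cycles in a unifiable semi-solved set *)

(** The summand 2 makes even a constant larger than a variable, as the decrease under [Orient]
    requires. *)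
Fixpoint tsize t : nat :=
  match t with
  | Var _ => 1
  | App f a => (\sum_(i < ar f) tsize (a i)).+2
  end.

Lemma tsize_occurs (s : V -> term) x t :
  occurs x t -> t = Var ar x \/ tsize (s x) < tsize (apply s t).
Proof.
suff le_occ u : occurs x u -> tsize (s x) <= tsize (apply s u).
  case: t => [y /eqP -> //|f a /existsP [i /le_occ le_i]]; first by left.
  right=> /=; rewrite ltnS (bigD1 i) //= ffunE.
  by apply: leq_trans le_i _; rewrite -addnS leq_addr.
elim: u => [y /= /eqP -> //|f a IH /existsP [i /IH le_i]] /=.
rewrite (bigD1 i) //= ffunE; apply: leq_trans le_i _.
by rewrite -!addnS leq_addr.
Qed.

(** By an equation [x = t], a variable of [t] has a smaller image than [x], or the same image if [t]
    is that variable. One strict edge makes a whole path strict. *)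
Lemma succ_var_or_smaller S s x y :
  unifier s S -> clos_trans V (succ S) x y ->
  clos_trans V (fun y z => (Var ar y, Var ar z) \in S) x y \/
  tsize (s y) < tsize (s x).
Proof.
move=> unif.
have var_eq (a b : V) : clos_trans V (fun y z => (Var ar y, Var ar z) \in S) a b ->
    s a = s b.
  by elim=> [c d /unif //|c d z _ -> _ ->].
elim=> [u v [_ [t utS vt]]|u v w _ [uv|uv] _ [vw|vw]].
- have /= -> := unif _ utS.
  by case: (tsize_occurs s vt) utS => [-> utS|]; [left; apply: t_step|right].
- by left; apply: t_trans uv vw.
- by right; rewrite (var_eq _ _ uv).
- by right; rewrite -(var_eq _ _ vw).
- by right; apply: ltn_trans uv.
Qed.

Lemma semi_solved_solved S s :
  semi_solved S -> unifier s S -> ~ var_cycle S -> solved S.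
Proof.
move=> [explS _ cycS] unif nocyc; split=> // x y t lhs_x ytS; apply/negP => xt.
have [xx|] := succ_var_or_smaller unif (cycS _ _ _ lhs_x ytS xt).
  by apply: nocyc; exists x.
by rewrite ltnn.
Qed.

(** * Final sets of MMA *)

(** Each rule that does not apply excludes a shape of equation; what is left is [x = t] with [x]
    neither in [t] nor in any other equation. *)
Lemma mma_final_solved S :
  (forall k e q, ~ mma_step S k e q) -> solved S.
Proof.
move=> final.
have shape e : e \in S -> exists x t,
    [/\ e = (Var ar x, t), ~~ occurs x t & ~ elsewhere S e x].
  case: e => -[x|f a] [y|g b] eS.
  - have [eq_xy|neq_xy] := eqVneq x y.
      by subst y; case: (final _ _ _ (MmaCommon (StepDelete eS))).
    exists x, (Var ar y); split=> //= else_x; apply: final.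
    exact: (MmaEliminate eS) else_x.
  - exists x, (App b).
    have nocc : ~~ occurs x (App b).
      by apply/negP => occ; case: (final _ _ _ (MmaOccurCheck eS occ _)).
    by split=> // else_x; case: (final _ _ _ (MmaEliminate eS nocc else_x)).
  - by case: (final _ _ _ (MmaCommon (StepOrient eS))).
  - have [eq_fg|/eqP neq_fg] := eqVneq f g.
      by subst g; case: (final _ _ _ (MmaCommon (StepDecompose eS))).
    by case: (final _ _ _ (MmaCommon (StepClash eS neq_fg))).
have other x t e : (Var ar x, t) \in S -> e \in S -> e <> (Var ar x, t) ->
    ~~ occurs_eqn x e.
  move=> xtS eS /eqP neq_e; have [y [u [[<- <-] _ alone]]] := shape _ xtS.
  by apply/negP => occ; case: alone; exists e; rewrite // in_fsetD1 neq_e.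
split; first split.
- by move=> e /shape [x [t [-> _ _]]]; exists x.
- move=> x t u xtS xuS; have [//|/eqP neq_tu] := eqVneq t u.
  have /negP [] := other _ _ _ xuS xtS (fun eq_e => neq_tu (congr1 snd eq_e)).
  by rewrite /occurs_eqn /= eqxx.
- move=> x y u [t xtS] yuS.
  have [eq_e|/eqP neq_e] := eqVneq (Var ar y, u) (Var ar x, t).
    by have [z [w [[<- <-] nocc _]]] := shape _ xtS; case: eq_e => _ ->.
  by have := other _ _ _ xtS yuS neq_e; rewrite negb_or => /andP [].
Qed.

(** * Termination of MMA *)

Definition occurs_in x E := has (occurs_eqn x) E.

(** The usual notion of a solved variable, boolean so that such variables can be counted. *)
Definition isolated E x :=
  has (fun e => [&& e.1 == Var ar x, ~~ occurs x e.2 &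
    all (fun e' => (e' == e) || ~~ occurs_eqn x e') E]) E.

Lemma isolatedP E x :
  reflect (exists t, [/\ (Var ar x, t) \in E, ~~ occurs x t &
      forall e, e \in E -> e <> (Var ar x, t) -> ~~ occurs_eqn x e])
    (isolated E x).
Proof.
apply: (iffP hasP) => [[[v t] vtE /and3P [/= /eqP eq_v nocc /allP other]]|].
  subst v; exists t; split=> // e eE neq_e.
  by have /orP [/eqP|] := other e eE.
move=> [t [xtE nocc other]]; exists (Var ar x, t) => //=; rewrite eqxx nocc /=.
by apply/allP => e eE; case: eqVneq => //= /eqP; apply: other.
Qed.

Fixpoint tvars t : seq V :=
  match t with
  | Var x => [:: x]
  | App f a => flatten (codom (fun i => tvars (a i)))
  end.

Lemma mem_tvars x t : (x \in tvars t) = occurs x t.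
Proof.
elim: t => [y|f a IH] /=; first by rewrite inE.
apply/flattenP/existsP => [[s /codomP [i ->]]|[i xi]].
  by rewrite IH => xi; exists i.
by exists (tvars (a i)); [apply/codomP; exists i|rewrite IH].
Qed.

Lemma occurs_bind x y t u :
  occurs y (apply (bind x t) u) -> occurs y t || occurs y u && (y != x).
Proof.
elim: u => [z|f a IH] /=.
  rewrite /bind; case: (eqVneq z x) => [_ ->//|neq_zx] /= /eqP ->.
  by rewrite eqxx neq_zx orbT.
move/existsP=> [i]; rewrite ffunE => /IH /orP [-> //|/andP [yi ->]].
by rewrite andbT; apply/orP; right; apply/existsP; exists i.
Qed.

Lemma occurs_eqn_bind x y t e :
  occurs_eqn y (apply_eqn (bind x t) e) ->
  occurs y t || occurs_eqn y e && (y != x).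
Proof.
rewrite /occurs_eqn => /orP [] /occurs_bind /orP [-> //|/andP [-> ->]];
by rewrite ?orbT.
Qed.

(** Confines the variables of a run to those of the initial set, so that the non-isolated ones can
    be counted in a fixed list. *)
Lemma mma_step_occurs_in E k e E' y :
  mma_step E k e (Eqns E') -> occurs_in y E' -> occurs_in y E.
Proof.
move Eq: (Eqns E') => q stepE /hasP [e' e'E' occ]; apply/hasP.
case: stepE Eq => [{}k {}e {}q|x t xtE nocc _ [eqE']|//]; last first.
  subst E'; case/fset1UP: e'E' occ => [-> occ|]; first by exists (Var ar x, t).
  move=> /imfsetP [e2 /= +] ->; rewrite in_fsetD1 => /andP [_ e2E].
  move=> /occurs_eqn_bind /orP [yt|/andP [ye2 _]]; last by exists e2.
  by exists (Var ar x, t); rewrite // /occurs_eqn /= yt orbT.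
case=> [f a b abE [eqE']|//|x xE [eqE']|f a x axE [eqE']]; subst E'.
- case/fsetUP: e'E'; first by rewrite in_fsetD1 => /andP [_]; exists e'.
  move=> /imfsetP [i /= _ eq_e']; subst e'; exists (App a, App b) => //.
  by case/orP: occ => /= occ; apply/orP; [left|right]; apply/existsP; exists i.
- by move: e'E'; rewrite in_fsetD1 => /andP [_]; exists e'.
- case/fset1UP: e'E'; last by rewrite in_fsetD1 => /andP [_]; exists e'.
  by move=> eq_e'; subst e'; exists (App a, Var ar x); rewrite // /occurs_eqn orbC.
Qed.

(** The critical case is [Eliminate] for some [x = t]. It cannot select the equation of [y], as [y]
    occurs nowhere else; so [t] is free of [y], and the substitution adds no occurrence of [y]. *)
Lemma mma_step_isolated E k e E' y :
  mma_step E k e (Eqns E') -> isolated E y -> isolated E' y.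
Proof.
move Eq: (Eqns E') => q stepE /isolatedP [u [yuE yu other]]; apply/isolatedP.
case: stepE Eq => [{}k {}e {}q|x t xtE nocc else_x [eqE']|//]; last first.
  have neq_e : (Var ar x, t) <> (Var ar y, u).
    move=> eq_e; case: else_x => e'; rewrite eq_e in_fsetD1 => /andP [/eqP ne' e'E].
    by case: eq_e => -> _; apply/negP; apply: other.
  have := other _ xtE neq_e; rewrite negb_or /= => /andP [neq_yx yt].
  have noty e2 : ~~ occurs_eqn y e2 -> ~~ occurs_eqn y (apply_eqn (bind x t) e2).
    by apply: contra => /occurs_eqn_bind; rewrite (negPf yt) => /andP [].
  have bind_y : bind x t y = Var ar y by rewrite /bind (negPf neq_yx).
  exists (apply (bind x t) u); subst E'; split.
  - apply/fset1UP; right; apply/imfsetP; exists (Var ar y, u) => /=.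
      by rewrite in_fsetD1 yuE andbT; apply/eqP => /esym.
    by rewrite /apply_eqn /= bind_y.
  - by apply/negP => /occurs_bind; rewrite (negPf yt) (negPf yu).
  - move=> e' /fset1UP [-> _|]; first exact: other.
    move=> /imfsetP [e2 /= + ->]; rewrite in_fsetD1 => /andP [_ e2E] neq_e2.
    apply/noty/other => // eq_e2; apply: neq_e2; by rewrite eq_e2 /apply_eqn /= bind_y.
case=> [f a b abE [eqE']|//|x xE [eqE']|f a x axE [eqE']]; exists u; subst E'; split=> //.
- by apply/fsetUP; left; rewrite in_fsetD1 yuE.
- move=> e'; case/fsetUP; first by rewrite in_fsetD1 => /andP [_]; apply: other.
  move=> /imfsetP [i /= _ ->] _; have : ~~ occurs_eqn y (App a, App b) by apply: other.
  rewrite /occurs_eqn !negb_or => /andP [ya yb]; apply/andP; split.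
    by apply: contra ya => occ; apply/existsP; exists i.
  by apply: contra yb => occ; apply/existsP; exists i.
- rewrite in_fsetD1 yuE andbT; apply/eqP => -[eq_yx eq_u].
  by rewrite eq_u eq_yx /= eqxx in yu.
- by move=> e'; rewrite in_fsetD1 => /andP [_]; apply: other.
- by apply/fset1UP; right; rewrite in_fsetD1 yuE.
- move=> e'; case/fset1UP=> [-> _|]; last by rewrite in_fsetD1 => /andP [_]; apply: other.
  by rewrite /occurs_eqn orbC; apply: (other (App a, Var ar x)).
Qed.

Lemma mma_eliminate_isolates E x t :
  (Var ar x, t) \in E -> ~~ occurs x t -> elsewhere E (Var ar x, t) x ->
  ~~ isolated E x /\ isolated (eliminate E x t) x.
Proof.
move=> xtE nocc else_x; split.
  apply/isolatedP => -[u [xuE _ other]].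
  have [eq_tu|/eqP neq_tu] := eqVneq t u; last first.
    have /negP [] := other _ xtE (fun eq_e => neq_tu (congr1 snd eq_e)).
    by rewrite /occurs_eqn /= eqxx.
  subst u; case: else_x => e; rewrite in_fsetD1 => /andP [/eqP neq_e eE].
  by apply/negP; apply: other.
apply/isolatedP; exists t; split=> // [|e]; first exact: fset1U1.
case/fset1UP=> [-> //|/imfsetP [e2 /= _ ->] _].
by apply/negP => /occurs_eqn_bind; rewrite (negPf nocc) eqxx andbF.
Qed.

(* The left-hand side counts twice, so that [Orient] decreases the weight. *)
Definition eqn_weight e := ((tsize e.1).*2 + tsize e.2)%N.

Definition weight E := \sum_(e <- E) eqn_weight e.

Lemma weightD1 E e : e \in E -> weight E = (eqn_weight e + weight (E `\ e))%N.
Proof. exact: big_fsetD1. Qed.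

(** Equations produced by a step may coincide with each other or with kept ones, so the new weight
    is only bounded by the sum over a list of them all. *)
Lemma weight_cover E (s : seq equation) :
  {subset E <= s} -> weight E <= \sum_(e <- s) eqn_weight e.
Proof.
move=> sub; apply: (sub_le_big_seq leqnn (fun m n => leq_addr n m)) => e.
rewrite count_uniq_mem ?fset_uniq //; case: (boolP (e \in _)) => // /sub.
by rewrite -has_pred1 has_count.
Qed.

(** [Eliminate] may increase the weight, but it isolates its variable. *)
Lemma mma_step_decreases E k e E' :
  mma_step E k e (Eqns E') ->
  weight E' < weight E \/
  exists x, [/\ occurs_in x E, ~~ isolated E x & isolated E' x].
Proof.
move Eq: (Eqns E') => q stepE.
case: stepE Eq => [{}k {}e {}q|x t xtE nocc else_x [->]|//]; last first.
  right; exists x; have [niso iso] := mma_eliminate_isolates xtE nocc else_x.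
  by split=> //; apply/hasP; exists (Var ar x, t); rewrite // /occurs_eqn /= eqxx.
case=> [f a b abE [->]|//|x xE [->]|f a x axE [->]]; left.
- rewrite (weightD1 abE).
  set E0 := E `\ _; pose s := codom (fun i : 'I_(ar f) => (a i, b i)).
  apply: (@leq_ltn_trans (\sum_(e' <- E0 ++ s) eqn_weight e')).
    apply: weight_cover => e'; rewrite mem_cat => /fsetUP [-> //|].
    by move=> /imfsetP [i /= _ ->]; rewrite codom_f orbT.
  rewrite big_cat [ltnRHS]addnC ltn_add2l big_map /eqn_weight /= big_enum /=.
  rewrite big_split /=.
  have -> : \sum_i (tsize (a i)).*2 = (\sum_i tsize (a i)).*2.
    by rewrite -muln2 big_distrl /=; apply: eq_bigr => i _; rewrite muln2.
  by rewrite !doubleS !addSn !addnS !ltnS; do ?apply: leqW.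
- by rewrite (weightD1 xE) -[ltnLHS]add0n ltn_add2r.
- rewrite (weightD1 axE); set E0 := E `\ _.
  apply: leq_ltn_trans (weight_cover (s := (Var ar x, App a) :: E0) _) _.
    by move=> e' /fset1UP [->|e'E0]; rewrite inE ?eqxx ?e'E0 ?orbT.
  rewrite big_cons ltn_add2r /eqn_weight /= !doubleS !addSn add0n addn1 !ltnS.
  by rewrite -addnn leq_addr.
Qed.

Lemma mma_no_infinite_run
    (S : nat -> eqset) (k : nat -> rule) (e : nat -> equation) :
  ~ forall i, mma_step (S i) (k i) (e i) (Eqns (S i.+1)).
Proof.
move=> steps.
(* The pair (number of variables of [S 0] not isolated in [S i], weight of [S i])
   decreases lexicographically. *)
pose W := flatten [seq tvars e.1 ++ tvars e.2 | e <- S 0].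
have occW i x : occurs_in x (S i) -> x \in W.
  elim: i => [|i IH] => [/hasP [e' e'S occ]|/(mma_step_occurs_in (steps i))//].
  apply/flattenP; exists (tvars e'.1 ++ tvars e'.2); first exact: map_f.
  by rewrite mem_cat !mem_tvars.
pose unsolved i := count (fun x => ~~ isolated (S i) x) W.
have unsolvedS i : unsolved i.+1 <= unsolved i.
  by apply: sub_count => x; apply: contra; apply: mma_step_isolated (steps i).
have unsolved_lt i x : occurs_in x (S i) -> ~~ isolated (S i) x ->
    isolated (S i.+1) x -> unsolved i.+1 < unsolved i.
  move=> /occW xW nx ix; rewrite /unsolved.
  have [s1 s2] := splitPr xW; rewrite !count_cat /= nx ix /= add0n addnCA add1n ltnS.
  by apply: leq_add; apply: sub_count => y; apply: contra; apply: mma_step_isolated (steps i).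
have descent m n i : unsolved i < m -> weight (S i) < n -> False.
  elim: m n i => [//|m IHm]; elim=> [//|n IHn] i lt_m lt_n.
  have [lt_w|[x [occ nx ix]]] := mma_step_decreases (steps i).
    exact: IHn (leq_ltn_trans (unsolvedS i) lt_m) (leq_trans lt_w lt_n).
  (* The weight may have grown here, so its bound is chosen afresh. *)
  exact: IHm (leq_trans (unsolved_lt _ _ occ nx ix) lt_m) (ltnSn _).
exact: descent 0 (ltnSn _) (ltnSn _).
Qed.

(** * Unifiability from a run of MMA, and correctness of MMA^- *)

Lemma mma_run_unifiable R E (r : trace V ar) :
  solution_relation R -> holds R E -> mma_run E r ->
  (forall i, performed r i -> act r i <> OccurCheck) -> unifiable E.
Proof.
move=> solR holdsE [mmaE final] noOC.
have mmamE := follows_mma_mmam mmaE noOC.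
(* [R] excludes [Clash], and [OccurCheck] is excluded by assumption, so no state reached is
   [Failure]. *)
have stE i : (forall j, j < i -> performed r j) -> exists T, st r i = Eqns T.
  by move/(mmam_holds solR mmamE); case: (st r i) => [T|] //; exists T.
case len_r: (len r) => [n|].
  have perf i : i < n -> performed r i by rewrite /performed len_r.
  have [T stT] := stE n perf.
  have solvedT : solved T.
    by apply: mma_final_solved => k e q; apply: final len_r stT.
  have [s repr_s] := explicit_represents solvedT.1.
  (* In the solution given by [s], the final set holds, hence so does [E]. *)
  exists s; have := mmam_holds (same_instance_sol s) mmamE perf.
  by rewrite stT => -[_]; apply; apply: (represents_mgu solvedT repr_s).1.
have perf i : performed r i by rewrite /performed len_r.
pose T i := if st r i is Eqns T then T else E.
have stT i : st r i = Eqns (T i).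
  by have [U stU] := stE i (fun j _ => perf j); rewrite /T stU.
case: (@mma_no_infinite_run T (act r) (sel r)) => i.
by have [U] := mmaE.2 i (perf i); rewrite !stT => -[<-].
Qed.

Lemma mgu_of_same_unifiers E S s :
  (forall s', unifier s' E <-> unifier s' S) -> mgu s S -> mgu s E.
Proof.
by move=> unifE [unif_s gen]; split=> [|s' /unifE]; [apply/unifE|apply: gen].
Qed.

End UnificationWithoutOccurCheck.

Theorem theorem7 (F V : choiceType) (ar : F -> nat) (E : eqset V ar) :
  (exists r : trace V ar,
     mma_run E r /\ forall i, performed r i -> act r i <> OccurCheck) ->
  forall (r : trace V ar) (n : nat),
    mmam_run E r -> mmam_terminates r n ->
    (~ unifiable E -> st r n = Failure V ar) /\
    (unifiable E ->
       exists S : eqset V ar, st r n = Eqns S /\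
         (~ var_cycle S ->
            solved S /\ exists s : subst V ar, represents S s /\ mgu s E)).
Proof.
move=> [r0 [run0 noOC]] r n [mmamE _] [len_r end_r].
have perf i : i < n -> performed r i by rewrite /performed len_r.
split=> [nunif|[s unif_s]].
  case: end_r => [//|[S stS semiS]]; case: nunif.
  have explS : explicit_form S by case: semiS.
  (* The solution that keeps the MMA run from failing is the tree equality of the final set of the
     other run. *)
  have solR := rational_eq_sol S.
  apply: (mma_run_unifiable solR) run0 noOC.
  have := mmam_holds solR mmamE perf; rewrite stS => -[_]; apply.
  exact: explicit_rational_eq.
(* For all substitutions at once: [E] has the unifiers of the final set, or none if the final state
   is [Failure]. *)
have unifE s' := mmam_holds (same_instance_sol s') mmamE perf.
case: end_r unifE => [-> /(_ s)/(_ unif_s)//|[S -> semiS] unifE].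
exists S; split=> // nocyc.
have solvedS := semi_solved_solved semiS ((unifE s).1 unif_s) nocyc.
have [s' repr_s'] := explicit_represents solvedS.1.
split=> //; exists s'; split=> //.
exact: mgu_of_same_unifiers unifE (represents_mgu solvedS repr_s').
Qed.
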